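(* Let $G$ be a graph on $n$ vertices, let $A\in\mathcal{S}(G)\subseteq\operatorname{Sym}_n(\mathbb{R})$ and let $J_A$ be its associated Jacobian matrix. Then $J_A$ has full rank if and only if the eigenvalues of $A$ are distinct and $A$ has the SSP.
   Context: Graphs are finite and simple. $\operatorname{Sym}_n(\mathbb{R})$ is the space of real symmetric $n\times n$ matrices. For a graph $G$ on vertex set $\{1,\ldots,n\}$, $\mathcal{S}(G)$ is the set of real symmetric $n\times n$ matrices whose off-diagonal $(i,j)$-entry is nonzero if and only if $\{i,j\}\in E(G)$; diagonal entries are arbitrary. A matrix $A\in\mathcal{S}(G)$ has the strong spectral property (SSP) if $T_1+T_2=\operatorname{Sym}_n(\mathbb{R})$, where $T_1=\operatorname{span}(\mathcal{S}(G))$ and $T_2=\{K^\top A+AK: K \text{ a real skew-symmetric } n\times n \text{ matrix}\}$. For a square matrix $M$, $s_k(M)$ is the sum of all $k\times k$ principal minors of $M$. The free positions of $A$ are the $n$ diagonal positions and the $m=|E(G)|$ positions corresponding to edges of $G$; list them as $e_1,\ldots,e_{n+m}$. Let $E_{e_j}$ be the symmetric $0$-$1$ matrix which has a single $1$ at position $(i,i)$ if $e_j$ is the diagonal position $i$, and has $1$'s exactly at positions $(a,b)$ and $(b,a)$ if $e_j$ is the edge $\{a,b\}$. The Jacobian matrix $J_A$ is the $n\times(n+m)$ matrix with $(i,j)$-entry $\frac{d}{dt}s_i(A+tE_{e_j})\big|_{t=0}$, for $i=1,\ldots,n$. Full rank means rank $n$. *)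

(* Defs.v *)
From HB Require Import structures.
From mathcomp Require Import all_boot all_order all_algebra.
From mathcomp Require Import classical_sets reals topology normedtype derive.

Set Implicit Arguments.
Unset Strict Implicit.
Unset Printing Implicit Defensive.

Import GRing.Theory Num.Theory numFieldNormedType.Exports.
Local Open Scope ring_scope.

Record graph (n : nat) := Graph {
  adj :> rel 'I_n;
  adj_sym : symmetric adj;
  adj_irr : irreflexive adj
}.

Definition edges n (G : graph n) : {set {set 'I_n}} :=
  [set [set p.1; p.2]%SET | p : 'I_n * 'I_n & G p.1 p.2]%SET.

Section SpectralProperty.
Variables (R : realType) (n : nat).

Definition Sym : set 'M[R]_n := [set A | A^T = A]%classic.

Definition SG (G : graph n) : set 'M[R]_n :=
  [set A | Sym A /\ forall i j, i != j -> (A i j != 0 <-> G i j)]%classic.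

Definition linear_span (S : set 'M[R]_n) : set 'M[R]_n :=
  [set B | exists k (c : 'I_k -> R) (M : 'I_k -> 'M[R]_n),
    (forall i, S (M i)) /\ B = \sum_(i < k) c i *: M i]%classic.

Definition T1 (G : graph n) : set 'M[R]_n := linear_span (SG G).

Definition T2 (A : 'M[R]_n) : set 'M[R]_n :=
  [set K^T *m A + A *m K | K in [set K : 'M[R]_n | K^T = - K]]%classic.

Definition SSP (G : graph n) (A : 'M[R]_n) : Prop :=
  [set M + N | M in T1 G & N in T2 A]%classic = Sym.

(* The multiset of real roots of the characteristic polynomial, which splits
   over R when A is symmetric, has no repetition. *)
Definition distinct_eigenvalues (A : 'M[R]_n) : Prop :=
  exists2 s : seq R, char_poly A = \prod_(a <- s) ('X - a%:P) & uniq s.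

End SpectralProperty.

Section Jacobian.
Variables (R : realType) (n : nat).

Definition principal_minor (I : {set 'I_n}) (M : 'M[R]_n) : R :=
  \det (mxsub (@enum_val _ (mem I)) (@enum_val _ (mem I)) M).

Definition sum_principal_minors (k : nat) (M : 'M[R]_n) : R :=
  \sum_(I : {set 'I_n} | #|I| == k) principal_minor I M.

(* The n diagonal positions come first, followed by the edges. *)
Definition free_position (G : graph n) (j : 'I_(n + #|edges G|)) :
    {set 'I_n} :=
  match split j with
  | inl d => [set d]%SET
  | inr e => enum_val e
  end.

(* For e = {i} this has its only 1 at (i, i), and for e = {a, b} with a != b
   its 1's are exactly at (a, b) and (b, a). *)
Definition position_mx (e : {set 'I_n}) : 'M[R]_n :=
  \matrix_(a, b) ([set a; b]%SET == e)%:R.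

(* Row i : 'I_n, numbered from 0, is the gradient of s_(i+1). *)
Definition graph_jacobian (G : graph n) (A : 'M[R]_n) :
    'M[R]_(n, n + #|edges G|) :=
  \matrix_(i, j) derive1
    (fun t : R => sum_principal_minors i.+1
       (A + t *: position_mx (free_position j))) 0.

End Jacobian.

(* Main.v *)
From HB Require Import structures.
Require Import Defs.
From mathcomp Require Import all_boot all_order all_algebra.
From mathcomp Require Import classical_sets reals topology normedtype derive.
From mathcomp Require Import perm complex.

(** Both conditions are about which matrices commuting with [A] vanish on all
    free positions.

    Rank of the Jacobian.  The sum [s_k] of principal minors is the coefficient
    of [X^(n-k)] in [det (X + A)], and the derivative of [det] at [Y] in the
    direction [E] is [tr (adj Y * E)].  Hence the derivative of [s_k] is
    [tr (N * E)], where [N] is the coefficient of [X^(n-k)] in [adj (X + A)].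
    Comparing coefficients in [(X + A) * adj (X + A) = det (X + A)] shows that
    [N] is a polynomial in [A] of degree exactly [k - 1]
    ([adj_coef_horner_mx]).  So the Jacobian is an invertible triangular matrix
    times the matrix of traces [tr (A^k * E_j)], and it has full rank iff there
    is no nonzero polynomial [p] of degree less than [n] such that [p(A)]
    vanishes on all free positions ([jacobian_full_rank],
    [traces_free_positions]).

    The strong spectral property.  For the trace form, the orthogonal
    complement of [T1] in the symmetric matrices consists of those vanishing on
    the free positions, and that of [T2] of those commuting with [A].  Hence
    the SSP says that a symmetric matrix which commutes with [A] and vanishes
    on the free positions is zero ([SSP_commutant]).

    The two are compared through the commutant of [A].  A symmetric matrix has
    distinct eigenvalues iff its minimal polynomial has degree [n]
    ([distinct_eigenvalues_degree]), and in that case the matrices commuting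
    with [A] are exactly the polynomials in [A] of degree less than [n]
    ([commutant_poly]), each coming from a single polynomial, so that the two
    conditions coincide.  If the minimal polynomial has degree less than [n],
    it is itself a nonzero [p] with [p(A)] vanishing on the free positions. *)

Set Implicit Arguments.
Unset Strict Implicit.
Unset Printing Implicit Defensive.
Import Order.TTheory GRing.Theory Num.Theory numFieldNormedType.Exports.
Local Open Scope ring_scope.

(** * Expansions of determinants *)

(** Each row of [A + B] is chosen from [A] or from [B], by multilinearity. *)
Lemma det_add (R : comNzRingType) n (A B : 'M[R]_n) :
  \det (A + B) =
  \sum_(J : {set 'I_n}) \det (\matrix_(i, j) if i \in J then A i j else B i j).
Proof.
rewrite /determinant.
under eq_bigr => s _ do under eq_bigr => i _ do rewrite mxE.
under eq_bigr => s _ do rewrite bigA_distr mulr_sumr.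
rewrite exchange_big; apply: eq_bigr => J _; apply: eq_bigr => s _.
by congr (_ * _); apply: eq_bigr => i _; rewrite mxE.
Qed.

Lemma det_mxsub_inj (R : comNzRingType) m n (f : 'I_m -> 'I_n) (M : 'M[R]_n) :
  m = n -> injective f -> \det (mxsub f f M) = \det M.
Proof.
move=> mn; case: n / mn f M => f M f_inj.
have -> : mxsub f f M = row_perm (perm f_inj) (col_perm (perm f_inj) M).
  by apply/matrixP=> i j; rewrite !mxE !permE.
rewrite row_permE col_permE !det_mulmx !det_perm.
by rewrite odd_permV mulrC -mulrA -signr_addb addbb mulr1.
Qed.

(** Listing [J] before its complement turns the matrix into a block upper
    triangular one, whose lower right block is scalar. *)
Lemma det_rows_scalar (R : comNzRingType) n (J : {set 'I_n}) (M : 'M[R]_n)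
    (x : R) :
  \det (\matrix_(i, j) if i \in J then M i j else (x%:M : 'M_n) i j) =
  x ^+ (n - #|J|) *
    \det (mxsub (@enum_val _ (mem J)) (@enum_val _ (mem J)) M).
Proof.
set N := (X in \det X = _).
(* The reindexing that lists J first. *)
pose f (k : 'I_(#|J| + #|~: J|)) : 'I_n :=
  match split k with inl a => enum_val a | inr b => enum_val b end.
have fl a : f (lshift _ a) = enum_val a by rewrite /f (unsplitK (inl a)).
have fr b : f (rshift _ b) = enum_val b by rewrite /f (unsplitK (inr b)).
have inJ (a : 'I_#|J|) : enum_val a \in J := enum_valP a.
have ninJ (b : 'I_#|~: J|) : (enum_val b \in J) = false.
  by have:= enum_valP b; rewrite inE => /negbTE.
have f_inj : injective f.
  move=> k l; case: (split_ordP k) => a ->; case: (split_ordP l) => b ->;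
    rewrite ?fl ?fr => e; first by rewrite (enum_val_inj e).
  - by have := inJ a; rewrite e ninJ.
  - by have := inJ b; rewrite -e ninJ.
  - by rewrite (enum_val_inj e).
have cardJ : (#|J| + #|~: J|)%N = n by rewrite cardsC card_ord.
rewrite -(det_mxsub_inj N cardJ f_inj) -[mxsub f f N]submxK.
have -> : dlsubmx (mxsub f f N) = 0.
  apply/matrixP=> b a; rewrite !mxE fl fr ninJ.
  by case: eqP => // e; have := inJ a; rewrite -e ninJ.
have -> : drsubmx (mxsub f f N) = x%:M.
  by apply/matrixP=> b a; rewrite !mxE !fr ninJ (inj_eq enum_val_inj).
rewrite det_ublock det_scalar mulrC.
have cardJc : #|~: J| = (n - #|J|)%N.
  by have /(congr1 (subn^~ #|J|)) := cardJ; rewrite addKn.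
rewrite -cardJc; congr (_ * \det _).
by apply/matrixP=> a b; rewrite !mxE !fl inJ.
Qed.

Lemma det_scalar_add (R : comNzRingType) n (M : 'M[R]_n) (x : R) :
  \det (x%:M + M) = \sum_(J : {set 'I_n}) x ^+ (n - #|J|) *
    \det (mxsub (@enum_val _ (mem J)) (@enum_val _ (mem J)) M).
Proof.
by rewrite addrC det_add; apply: eq_bigr => J _; apply: det_rows_scalar.
Qed.

(** Jacobi's formula for the derivative of the determinant, in formal terms:
    the coefficient of the first power of ['X] collects the choices of rows
    in which exactly one row comes from [E]. *)
Lemma coef1_det (R : comNzRingType) n (Y E : 'M[R]_n) :
  (\det (map_mx polyC Y + 'X *: map_mx polyC E))`_1 = \tr (\adj Y *m E).
Proof.
pose N (J : {set 'I_n}) := \matrix_(i, j) if i \in J then E i j else Y i j.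
have detN (J : {set 'I_n}) : \det (\matrix_(i, j) if i \in J
    then ('X *: map_mx polyC E) i j else map_mx polyC Y i j)
    = 'X^#|J| * (\det (N J))%:P.
  have -> : (\matrix_(i, j) if i \in J
      then ('X *: map_mx polyC E) i j else map_mx polyC Y i j) =
      diag_mx (\row_i if i \in J then 'X else 1) *m map_mx polyC (N J).
    apply/matrixP=> i j; rewrite mul_diag_mx !mxE.
    by case: ifP => _; rewrite ?mul1r.
  rewrite det_mulmx det_diag det_map_mx; congr (_ * _).
  under eq_bigr => i _ do rewrite mxE.
  by rewrite -big_mkcond prodr_const.
rewrite addrC det_add coef_sum.
under eq_bigr => J _ do rewrite detN coefXnM coefC.
transitivity (\sum_(J : {set 'I_n} | #|J| == 1%N) \det (N J)).
  rewrite [RHS]big_mkcond; apply: eq_bigr => J _.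
  by case: #|J| => [|[|k]] /=.
have -> : \sum_(J : {set 'I_n} | #|J| == 1%N) \det (N J) =
          \sum_i \det (N [set i]%SET).
  rewrite (reindex_omap (fun i => [set i]%SET) (@finset.unset1 _));
    last by move=> J /cards1P[i ->]; rewrite set1K.
  by apply: eq_bigl => i; rewrite set1K cards1 !eqxx.
rewrite mxtrace_mulC /mxtrace; apply: eq_bigr => i _.
rewrite (expand_det_row _ i) mxE; apply: eq_bigr => j _.
rewrite !mxE inE eqxx; congr (_ * _); congr (_ * \det _).
by apply/matrixP=> k l; rewrite !mxE inE eq_sym (negbTE (neq_lift _ _)).
Qed.

(** * Coefficients of the adjugate of X + A *)

Section AdjugateCoefficients.
Variable R : comNzRingType.

Definition adj_coef n (A : 'M[R]_n) j : 'M[R]_n :=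
  map_mx (coefp j) (\adj ('X%:M + map_mx polyC A)).

(** The coefficient of [X^(j+1)] in [Y * adj Y = det Y], for [Y = X + A]. *)
Lemma adj_coef_rec n (A : 'M[R]_n) j :
  adj_coef A j + A *m adj_coef A j.+1 =
  ((\det ('X%:M + map_mx polyC A))`_j.+1)%:M.
Proof.
set Y := 'X%:M + map_mx _ _; have := mul_mx_adj Y.
rewrite {1}/Y mulmxDl mul_scalar_mx.
move=> /(congr1 (map_mx (coefp j.+1))) => e.
transitivity (map_mx (coefp j.+1) ((\det Y)%:M : 'M_n)); last first.
  by apply/matrixP=> a b; rewrite !mxE raddfMn.
rewrite -e; apply/matrixP=> a b; rewrite !mxE /= coefD coefXM coef_sum.
by congr (_ + _); apply: eq_bigr => c _; rewrite !mxE coefCM.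
Qed.

(** Downward induction from a degree above that of all entries: from [n] on,
    the recurrence has no contribution from the determinant, whose degree
    is [n]. *)
Lemma adj_coef_ge n (A : 'M[R]_n) j : (n <= j)%N -> adj_coef A j = 0.
Proof.
set Y := 'X%:M + map_mx polyC A.
have det0 l : (n <= l)%N -> (\det Y)`_l.+1 = 0.
  move=> le_nl; apply: nth_default.
  have -> : Y = char_poly_mx (- A) by rewrite /char_poly_mx raddfN opprK.
  by rewrite -/(char_poly _) size_char_poly ltnS.
have down m l : (n <= l)%N -> adj_coef A (l + m) = 0 -> adj_coef A l = 0.
  elim: m l => [|m IHm] l le_nl; first by rewrite addn0.
  rewrite addnS -addSn => /IHm N0; have := adj_coef_rec A l.
  by rewrite N0 ?(leqW le_nl) // mulmx0 addr0 det0 // raddf0.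
move=> le_nj; apply: (down (\max_a \max_b size (\adj Y a b)) j le_nj).
apply/matrixP=> a b; rewrite mxE [RHS]mxE /= nth_default //.
apply: leq_trans (leq_addl _ _).
apply: leq_trans (@leq_bigmax _ (fun c => size (\adj Y a c)) b) _.
exact: (@leq_bigmax _ (fun c => \max_d size (\adj Y c d)) a).
Qed.

End AdjugateCoefficients.

(** * Gradients of the sums of principal minors *)

Section MinorSums.
Variable R : realType.

Lemma coef_det_XD n (M : 'M[R]_n) k : (k <= n)%N ->
  (\det ('X%:M + map_mx polyC M))`_(n - k) = sum_principal_minors k M.
Proof.
move=> le_kn; rewrite det_scalar_add coef_sum [RHS]big_mkcond /=.
apply: eq_bigr => J _; rewrite -map_mxsub det_map_mx mulrC coefCM coefXn.
have leJ : (#|J| <= n)%N by rewrite -[X in (_ <= X)%N]card_ord max_card.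
have -> : (n - k == n - #|J|)%N = (#|J| == k).
  by apply/eqP/eqP => [e|->//]; rewrite -(subKn leJ) -e subKn.
by case: eqP => _; rewrite ?mulr1 ?mulr0.
Qed.

(** [s_k (A + t E)] is a polynomial in [t], read off from the polynomial [D] in
    two variables: its coefficients are those of [D] in the outer variable [t],
    taken at [X^(n-k)]. *)
Lemma derive_sum_principal_minors n (A E : 'M[R]_n) k : (k <= n)%N ->
  derive1 (fun t : R => sum_principal_minors k (A + t *: E)) 0 =
  \tr (adj_coef A (n - k) *m E).
Proof.
move=> le_kn; pose Y : 'M[{poly R}]_n := 'X%:M + map_mx polyC A.
pose D : {poly {poly R}} :=
  \det (map_mx polyC Y + 'X *: map_mx polyC (map_mx polyC E)).
pose P : {poly R} := \poly_(j < size D) (D`_j)`_(n - k).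
have -> : (fun t : R => sum_principal_minors k (A + t *: E)) = horner P.
  apply: boolp.funext => t; rewrite -coef_det_XD //.
  have -> : \det ('X%:M + map_mx polyC (A + t *: E)) = D.[t%:P].
    rewrite -[D.[_]]/(horner_eval t%:P D) /D -det_map_mx; congr (\det _).
    apply/matrixP=> i j; rewrite !mxE rmorphD rmorphM /=.
    by rewrite /horner_eval !hornerE.
  rewrite horner_coef horner_poly coef_sum; apply: eq_bigr => j _.
  by rewrite -polyC_exp coefMC.
rewrite -derivE -[0]/(0 : R) horner_coef0 coef_deriv coef_poly.
transitivity ((D`_1)`_(n - k)).
  by case: ltnP => // /(nth_default 0) ->; rewrite coef0 mul0rn.
rewrite coef1_det /mxtrace coef_sum; apply: eq_bigr => i _.
by rewrite !mxE coef_sum; apply: eq_bigr => j _; rewrite !mxE coefMC.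
Qed.

End MinorSums.

(** * The rank of the Jacobian *)

Lemma horner_mx_sum (R : comNzRingType) n' (A : 'M[R]_n'.+1) (p : {poly R}) d :
  (size p <= d)%N ->
  horner_mx A p = \sum_(i < d) p`_i *: A ^+ i.
Proof.
move=> le_pd; have e : p = \poly_(i < d) p`_i.
  apply/polyP => i; rewrite coef_poly; case: ltnP => // le_di.
  by rewrite nth_default // (leq_trans le_pd).
rewrite {1}e poly_def linear_sum; apply: eq_bigr => i _.
by rewrite linearZ /= rmorphXn /= horner_mx_X.
Qed.

Lemma trace_horner_mx (R : comNzRingType) n' (A E : 'M[R]_n'.+1)
    (p : {poly R}) d :
  (size p <= d)%N ->
  \tr (horner_mx A p *m E) = \sum_(i < d) p`_i * \tr (A ^+ i *m E).
Proof.
move=> le_pd; rewrite (horner_mx_sum A le_pd) mulmx_suml linear_sum.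
by apply: eq_bigr => i _; rewrite -scalemxAl linearZ.
Qed.

Lemma tr_horner_mx (R : comNzRingType) n' (A : 'M[R]_n'.+1) (p : {poly R}) :
  (horner_mx A p)^T = horner_mx A^T p.
Proof.
elim/poly_ind: p => [|p c IHp]; first by rewrite !raddf0.
rewrite !rmorphD !rmorphM /= !horner_mx_X !horner_mx_C linearD /= trmx_mul IHp.
by rewrite tr_scalar_mx; congr (_ + _); apply/comm_mx_horner.
Qed.

Section JacobianRank.
Variables (R : realType) (n' : nat).
Local Notation n := n'.+1.

(** For [k < n], its value at [A] is the coefficient of [X^(n-1-k)] in
    [adj (X + A)]; the recursion is that of [adj_coef_rec]. *)
Fixpoint adj_poly (A : 'M[R]_n) k : {poly R} :=
  if k is l.+1 then (sum_principal_minors k A)%:P - 'X * adj_poly A l else 1.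

Lemma size_adj_poly (A : 'M[R]_n) k : size (adj_poly A k) = k.+1.
Proof.
elim: k => [|k IHk] /=; first by rewrite size_polyC oner_eq0.
have nz : adj_poly A k != 0 by rewrite -size_poly_gt0 IHk.
rewrite addrC size_polyDl size_polyN mulrC size_mulX ?IHk //.
by rewrite (leq_ltn_trans (size_polyC_leq1 _)).
Qed.

Lemma adj_coef_horner_mx (A : 'M[R]_n) k : (k < n)%N ->
  adj_coef A (n' - k) = horner_mx A (adj_poly A k).
Proof.
have s0 (M : 'M[R]_n) : sum_principal_minors 0 M = 1.
  rewrite /sum_principal_minors (big_pred1 (finset.set0 : {set 'I_n}));
    last by move=> J; exact: cards_eq0.
  rewrite /principal_minor; move: (mxsub _ _ M); rewrite cards0 => N.
  exact: det_mx00.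
elim: k => [|k IHk] ltkn.
  have := adj_coef_rec A n'.
  rewrite (adj_coef_ge A (leqnn n)) mulmx0 addr0 subn0 => ->.
  have := coef_det_XD A (leq0n n); rewrite subn0 s0 => ->.
  by rewrite !rmorph1.
have := adj_coef_rec A (n' - k.+1).
rewrite -subSn // subSS IHk 1?ltnW // => /(canRL (addrK _)) ->.
rewrite -[(n' - k)%N]subSS coef_det_XD 1?ltnW //.
by rewrite [adj_poly _ k.+1]/= rmorphB rmorphM /= horner_mx_C horner_mx_X.
Qed.

Definition power_traces (G : graph n) (A : 'M[R]_n) :
    'M[R]_(n, n + #|edges G|) :=
  \matrix_(k, j) \tr (A ^+ k *m position_mx R (free_position j)).

(** The left factor is triangular, as the [k]-th polynomial has degree
    exactly [k]. *)
Lemma graph_jacobianE (G : graph n) (A : 'M[R]_n) :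
  graph_jacobian G A =
  (\matrix_(i < n, l < n) (adj_poly A i)`_l) *m power_traces G A.
Proof.
apply/matrixP=> i j; rewrite !mxE derive_sum_principal_minors ?ltn_ord //.
rewrite subSS adj_coef_horner_mx //.
rewrite (@trace_horner_mx _ _ _ _ _ n) ?size_adj_poly //.
by apply: eq_bigr => l _; rewrite !mxE.
Qed.

Lemma rank_graph_jacobian (G : graph n) (A : 'M[R]_n) :
  \rank (graph_jacobian G A) = \rank (power_traces G A).
Proof.
rewrite graph_jacobianE; apply/eqmx_rank/eqmxP/eqmxMfull.
set Q := (X in row_full X).
have trigQ : is_trig_mx Q.
  apply/is_trig_mxP=> i j lt_ij.
  by rewrite mxE nth_default // size_adj_poly.
rewrite row_full_unit unitmxE det_trig // unitfE.
apply/prodf_neq0 => i _; rewrite mxE.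
have := lead_coef_eq0 (adj_poly A i).
by rewrite lead_coefE size_adj_poly -size_poly_eq0 size_adj_poly /= => ->.
Qed.

(** Row vectors are read as polynomials in [A]: full rank means that the row
    kernel of the matrix of traces is trivial. *)
Lemma jacobian_full_rank (G : graph n) (A : 'M[R]_n) :
  \rank (graph_jacobian G A) = n <->
  forall p : {poly R}, (size p <= n)%N ->
    (forall j,
       \tr (horner_mx A p *m position_mx R (@free_position _ G j)) = 0) ->
  p = 0.
Proof.
rewrite rank_graph_jacobian.
have trE (u : 'rV[R]_n) j : (u *m power_traces G A) 0 j =
    \tr (horner_mx A (rVpoly u) *m position_mx R (free_position j)).
  rewrite (@trace_horner_mx _ _ _ _ _ n) ?size_poly // mxE.
  by apply: eq_bigr => i _; rewrite mxE coef_rVpoly_ord.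
split=> [/eqP free_tr p size_p tr0 | inj_tr].
  rewrite -(poly_rV_K size_p) -[RHS](raddf0 (@rVpoly R n)); congr rVpoly.
  apply: (row_free_inj free_tr); rewrite mul0mx; apply/rowP=> j.
  by rewrite trE poly_rV_K // tr0 mxE.
apply/eqP/inj_row_free => u uW0; rewrite -[u]rVpolyK.
rewrite (inj_tr (rVpoly u)) ?raddf0 ?size_poly // => j.
by rewrite -trE uW0 mxE.
Qed.

End JacobianRank.

(** * Symmetric matrices with distinct eigenvalues *)

Lemma interpolation (K : fieldType) m (d y : 'I_m -> K) : injective d ->
  exists p : {poly K}, forall i, p.[d i] = y i.
Proof.
move=> d_inj; pose L i := \prod_(j | j != i) ('X - (d j)%:P).
exists (\sum_i (y i / (L i).[d i]) *: L i) => i.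
rewrite horner_sum (bigD1 i) //= big1 ?addr0 => [|j ne_ji].
  rewrite hornerZ divfK // horner_prod; apply/prodf_neq0 => j ne_ji.
  by rewrite hornerXsubC subr_eq0 inj_eq // eq_sym.
rewrite hornerZ [X in _ * X]horner_prod (bigD1 i) 1?eq_sym //=.
by rewrite hornerXsubC subrr mul0r mulr0.
Qed.

Section SymmetricSpectrum.
Variables (R : realType) (n' : nat).
Local Notation n := n'.+1.
Implicit Type A : 'M[R]_n.

(** Seen over the complex numbers, [A] is Hermitian, hence unitarily
    diagonalizable with a real diagonal; minimal polynomials are invariant
    under conjugation and field extension. *)
Lemma symmetric_minpoly_split A : A^T = A ->
  exists2 rs : seq R, uniq rs & mxminpoly A = \prod_(r <- rs) ('X - r%:P).
Proof.
move=> symA; pose toC : {rmorphism R -> R[i]} := real_complex R.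
pose B := map_mx toC A.
have hermB : B \is hermsymmx.
  apply: realsym_hermsym.
    apply/is_hermitianmxP; apply/matrixP=> i j.
    by rewrite !mxE /= expr0 mul1r -[in LHS]symA mxE.
  by apply/mxOverP=> i j; rewrite mxE; apply/complex_realP; exists (A i j).
have /hermitian_normalmx/orthomx_spectralP eqB := hermB.
have /mxOverP realD := hermitian_spectral_diag_real hermB.
pose d := map_mx (@complex.Re R) (spectral_diag B).
have dE : spectral_diag B = map_mx toC d.
  by apply/rowP=> i; rewrite !mxE /= RRe_real.
exists (undup [seq d 0 i | i <- enum 'I_n]); first exact: undup_uniq.
apply: (map_poly_inj toC); rewrite -mxminpoly_map -/B eqB.
rewrite -conjVmx ?spectral_unit //.
rewrite mxminpoly_uconj ?unitmx_inv ?spectral_unit //.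
by rewrite dE -map_diag_mx mxminpoly_map mxminpoly_diag.
Qed.

(** The minimal polynomial divides the characteristic one, has the same roots
    and only simple roots; so they agree iff the characteristic polynomial
    has no repeated root. *)
Lemma distinct_eigenvalues_degree A : A^T = A ->
  distinct_eigenvalues A <-> degree_mxminpoly A = n.
Proof.
move=> symA; split=> [[s charA uniq_s] | degA].
  apply/eqP; rewrite -eqSS -size_mxminpoly -(size_char_poly A) eqn_leq.
  rewrite dvdp_leq ?mxminpoly_dvd_char ?monic_neq0 ?char_poly_monic //=.
  rewrite dvdp_leq ?monic_neq0 ?mxminpoly_monic // charA.
  apply: uniq_roots_dvdp; last by rewrite uniq_rootsE.
  by apply/allP=> a; rewrite root_mxminpoly charA root_prod_XsubC.
have [rs uniq_rs minA] := symmetric_minpoly_split symA.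
exists rs => //; rewrite -minA; apply/eqP.
rewrite -eqp_monic ?char_poly_monic ?mxminpoly_monic // eqp_sym.
rewrite -dvdp_size_eqp ?mxminpoly_dvd_char //.
by rewrite size_mxminpoly size_char_poly degA.
Qed.

(** In a basis of eigenvectors, a matrix commuting with [A] commutes with a
    diagonal matrix of distinct entries; it is then diagonal itself, and
    interpolation makes it a polynomial in that matrix. *)
Lemma commutant_poly A X : A^T = A -> degree_mxminpoly A = n ->
  A *m X = X *m A ->
  exists2 p : {poly R}, (size p <= n)%N & X = horner_mx A p.
Proof.
move=> symA degA commAX.
suff [p Xp] : exists p, X = horner_mx A p.
  exists (mx_inv_horner A X); first by rewrite -degA size_poly.
  by rewrite mx_inv_hornerK // Xp horner_mx_mem.
have [rs uniq_rs minA] := symmetric_minpoly_split symA.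
have [P uP /similar_diagPex[d /(similarLR uP) Ad]] : diagonalizable A.
  by apply/diagonalizableP; exists rs => //; rewrite minA.
have d_inj : injective (d 0).
  have: size (mxminpoly A) = n.+1 by rewrite size_mxminpoly degA.
  rewrite Ad mxminpoly_uconj ?unitmx_inv // mxminpoly_diag size_prod_XsubC.
  (* There are n distinct roots among the n diagonal entries. *)
  move=> -[] size_d; apply/injectiveP; rewrite /injectiveb /dinjectiveb.
  by rewrite -[uniq _]negbK -ltn_size_undup size_d size_map size_enum_ord ltnn.
rewrite conjVmx // in Ad.
have [Y XY commY] : exists2 Y, X = invmx P *m Y *m P &
    diag_mx d *m Y = Y *m diag_mx d.
  exists (P *m X *m invmx P).
    by rewrite !mulmxA mulVmx // mul1mx mulmxKV.
  have -> : diag_mx d = P *m A *m invmx P.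
    by rewrite Ad !mulmxA mulmxV // mul1mx mulmxK.
  by rewrite !mulmxA !mulmxKV // -!(mulmxA P) commAX.
have [p pd] := interpolation (fun i => Y i i) d_inj.
exists p; rewrite Ad XY horner_mx_uconjC // horner_mx_diag.
congr (_ *m _ *m _); apply/esym/matrixP=> i j; rewrite !mxE.
have [<-|ne_ij] := eqVneq i j; first by rewrite mulr1n pd.
have /matrixP/(_ i j) := commY; rewrite mul_diag_mx mul_mx_diag !mxE.
rewrite mulrC => /eqP; rewrite -subr_eq0 -mulrBr mulf_eq0 subr_eq0.
by rewrite (inj_eq d_inj) (negbTE ne_ij) orbF => /eqP ->.
Qed.

End SymmetricSpectrum.

(** * Vanishing on the free positions *)

Definition free_pair n (G : graph n) : rel 'I_n := fun a b => (a == b) || G a b.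

Lemma free_pair_sym n (G : graph n) : symmetric (free_pair G).
Proof. by move=> a b; rewrite /free_pair eq_sym adj_sym. Qed.

Lemma free_position_pair n (G : graph n) j :
  exists a b, free_pair G a b /\ @free_position _ G j = [set a; b]%SET.
Proof.
rewrite /free_position; case: (split j) => [d | e].
  by exists d, d; rewrite /free_pair eqxx finset.setUid.
have /imsetP[[a b]] := enum_valP e; rewrite inE /= => Gab ->.
by exists a, b; split=> //; rewrite /free_pair Gab orbT.
Qed.

Lemma pair_free_position n (G : graph n) a b : free_pair G a b ->
  exists j, @free_position _ G j = [set a; b]%SET.
Proof.
case/orP=> [/eqP <- | Gab].
  exists (lshift _ a); rewrite /free_position (unsplitK (inl a)).
  by rewrite finset.setUid.
have Eab : [set a; b]%SET \in edges G.
  by apply/imsetP; exists (a, b); rewrite ?inE.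
exists (rshift _ (enum_rank_in Eab [set a; b]%SET)).
by rewrite /free_position (unsplitK (inr _)) enum_rankK_in.
Qed.

Lemma eq_set2 (T : finType) (a b c d : T) :
  [set a; b]%SET = [set c; d]%SET -> a = c /\ b = d \/ a = d /\ b = c.
Proof.
move/setP => e; move: (e a) (e b) (e c) (e d).
rewrite !inE !eqxx /= ?orbT.
move=> /esym/orP ha /esym/orP hb /orP hc /orP hd.
by case: ha hb hc hd => /eqP-> [] /eqP-> [] /eqP ? [] /eqP ?; subst; auto.
Qed.

Section PositionTraces.
Variables (R : realType) (n : nat).
Implicit Type X : 'M[R]_n.

(** The trace is a sum of copies of [X a b], one for each of the one or two
    positions of the pair; [c] is their number. *)
Lemma trace_position X a b : X^T = X ->
  \tr (X *m position_mx R [set a; b]%SET) = 0 <-> X a b = 0.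
Proof.
move=> symX; pose c : R := \sum_i \sum_j position_mx R [set a; b]%SET j i.
have c_gt0 : 0 < c.
  rewrite /c (bigD1 b) //= (bigD1 a) //= mxE eqxx.
  rewrite ltr_wpDr ?ltr_wpDr ?ltr01 ?sumr_ge0 // => i _;
    rewrite ?mxE ?ler0n ?sumr_ge0 // => j _; by rewrite mxE ler0n.
have -> : \tr (X *m position_mx R [set a; b]%SET) = X a b * c.
  rewrite /mxtrace mulr_sumr; apply: eq_bigr => i _.
  rewrite mxE mulr_sumr; apply: eq_bigr => j _.
  rewrite mxE; case: eqP => [/eq_set2 | _]; last by rewrite !mulr0.
  by rewrite !mulr1 => -[[-> ->]|[-> ->]] //; rewrite -[in LHS]symX mxE.
split=> [/eqP|->]; last by rewrite mul0r.
by rewrite mulf_eq0 (gt_eqF c_gt0) orbF => /eqP.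
Qed.

Lemma traces_free_positions (G : graph n) X : X^T = X ->
  (forall j, \tr (X *m position_mx R (@free_position _ G j)) = 0) <->
  (forall a b, free_pair G a b -> X a b = 0).
Proof.
move=> symX; split=> [tr0 a b /pair_free_position[j ej] | X0 j].
  by apply/trace_position; rewrite // -ej.
have [a [b [Gab ->]]] := free_position_pair j.
exact/trace_position/X0.
Qed.

End PositionTraces.

(** * The trace form and the strong spectral property *)

Lemma trace_trmx_mul (R : comNzRingType) n (X Y : 'M[R]_n) :
  \tr (X^T *m Y) = \sum_a \sum_b X a b * Y a b.
Proof.
rewrite exchange_big; apply: eq_bigr => b _; rewrite mxE.
by apply: eq_bigr => a _; rewrite mxE.
Qed.

Lemma trace_square_ge0 (R : realDomainType) n (X : 'M[R]_n) :
  0 <= \tr (X^T *m X).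
Proof.
rewrite trace_trmx_mul; apply: sumr_ge0 => a _; apply: sumr_ge0 => b _.
by rewrite -expr2 sqr_ge0.
Qed.

Lemma trace_square_eq0 (R : realDomainType) n (X : 'M[R]_n) :
  \tr (X^T *m X) = 0 -> X = 0.
Proof.
rewrite trace_trmx_mul => /eqP; rewrite psumr_eq0 => [/allP X0|a _]; last first.
  by apply: sumr_ge0 => b _; rewrite -expr2 sqr_ge0.
apply/matrixP=> a b; rewrite mxE; have := X0 a (mem_index_enum a).
rewrite psumr_eq0 => [/allP/(_ b (mem_index_enum b))|c _]; last first.
  by rewrite -expr2 sqr_ge0.
by rewrite mulf_eq0 orbb => /eqP.
Qed.

Section Bracket.
Variables (R : comNzRingType) (n : nat).
Implicit Types A X Y : 'M[R]_n.

Definition bracket A X : 'M[R]_n := A *m X - X *m A.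

Lemma bracket_is_linear A : linear (bracket A).
Proof.
move=> k X Y; rewrite /bracket mulmxDr mulmxDl -scalemxAr -scalemxAl.
by rewrite opprD addrACA scalerBr.
Qed.

HB.instance Definition _ A :=
  GRing.isLinear.Build R 'M[R]_n 'M[R]_n _ (bracket A) (bracket_is_linear A).

Lemma bracket_tr A X : A^T = A -> bracket A X^T = - (bracket A X)^T.
Proof. by move=> symA; rewrite linearB /= !trmx_mul symA opprB. Qed.

End Bracket.

Lemma linear_inj_surj (K : fieldType) m n
    (f : {linear 'M[K]_(m, n) -> 'M[K]_(m, n)}) :
  injective f -> forall Y, exists X, f X = Y.
Proof.
move=> f_inj Y; have uf : lin_mx f \in unitmx.
  rewrite -row_free_unit; apply: inj_row_free => v; rewrite mul_rV_lin.
  move/(congr1 vec_mx); rewrite mxvecK raddf0 => fv0.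
  by rewrite -[v]vec_mxK (f_inj (vec_mx v) 0) ?raddf0.
exists (vec_mx (mxvec Y *m invmx (lin_mx f))).
by apply: (can_inj mxvecK); rewrite -mul_rV_lin mulmxKV.
Qed.

Section StrongSpectralProperty.
Variables (R : realType) (n : nat) (G : graph n).
Implicit Types X Y K A B : 'M[R]_n.

(** A matrix with the zero pattern of [T1] need not have the exact pattern of
    [G], since entries at edges may vanish.  Adding a large multiple of the
    adjacency matrix makes them all nonzero, and shows the matrix as a
    difference of two members of [SG G]. *)
Lemma T1P B : T1 G B <->
  B^T = B /\ forall a b, ~~ free_pair G a b -> B a b = 0.
Proof.
split=> [[k [c [M [GM ->]]]] | [symB B0]].
  split=> [|a b nGab].
    rewrite linear_sum; apply: eq_bigr => i _.
    by rewrite linearZ /=; have [-> _] := GM i.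
  rewrite summxE big1 // => i _; rewrite mxE.
  move: nGab; rewrite negb_or => /andP[ne_ab nGab].
  have [_ /(_ a b ne_ab) GMi] := GM i.
  by case: (eqVneq (M i a b) 0) => [-> | /GMi]; rewrite ?mulr0 ?(negbTE nGab).
pose M0 : 'M[R]_n := \matrix_(a, b) (G a b)%:R.
pose c : R := 1 + \sum_a \sum_b `|B a b|.
have c_gt a b : `|B a b| < c.
  apply: (@le_lt_trans _ _ (\sum_a \sum_b `|B a b|));
    last by rewrite ltrDr ltr01.
  rewrite (bigD1 a) //= (bigD1 b) //= -addrA lerDl addr_ge0 ?sumr_ge0 // => i _.
  exact: sumr_ge0.
have SGM0 : SG G M0.
  split=> [|a b ne_ab]; first by apply/matrixP=> a b; rewrite !mxE adj_sym.
  by rewrite mxE pnatr_eq0 eqb0 negbK.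
have c_gt0 : 0 < c by rewrite ltr_pwDl // sumr_ge0 // => a _; exact: sumr_ge0.
have SGB : SG G (B + c *: M0).
  split=> [|a b ne_ab].
    change ((B + c *: M0)^T = B + c *: M0); rewrite linearD linearZ /= symB.
    by have [-> _] := SGM0.
  rewrite !mxE; case: (boolP (G a b)) => [Gab | nGab]; last first.
    by rewrite B0 ?negb_or ?ne_ab // mulr0 addr0 eqxx.
  split=> // _; rewrite mulr1 addr_eq0; apply: contraTneq (c_gt a b) => ->.
  by rewrite normrN ger0_norm ?ltxx // ltW.
exists 2%N, (fun i => if i == ord0 then 1 else - c),
  (fun i => if i == ord0 then B + c *: M0 else M0); split=> [i|].
  by case: ifP.
by rewrite !big_ord_recl big_ord0 /= scale1r addr0 scaleNr addrK.
Qed.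

Definition free_part X : 'M[R]_n :=
  \matrix_(a, b) if free_pair G a b then X a b else 0.

(** An operator whose quadratic form is the sum of the squared norms of the
    free part of [X], of [bracket A X] and, up to a factor, of the skew part of
    [X] ([ssp_operator_form]).  For symmetric [X] the first term lies in [T1],
    the second one in [T2], as [bracket A X] is then skew, and the third one
    vanishes: inverting the operator splits a symmetric matrix along
    [T1 + T2]. *)
Definition ssp_operator A X : 'M[R]_n :=
  free_part X + bracket A (bracket A X) + (X - X^T).

Lemma ssp_operator_is_linear A : linear (ssp_operator A).
Proof.
move=> k X Y; rewrite /ssp_operator !bracket_is_linear.
have -> : free_part (k *: X + Y) = k *: free_part X + free_part Y.
  by apply/matrixP=> a b; rewrite !mxE; case: ifP; rewrite ?mulr0 ?addr0.
have -> : k *: X + Y - (k *: X + Y)^T = k *: (X - X^T) + (Y - Y^T).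
  by rewrite linearD linearZ /= opprD addrACA scalerBr.
by rewrite [X in X + _ = _]addrACA -scalerDr [LHS]addrACA -scalerDr.
Qed.

Lemma ssp_operator_tr A X : A^T = A ->
  ssp_operator A X^T = (ssp_operator A X)^T.
Proof.
move=> symA.
have brr : bracket A (bracket A X^T) = (bracket A (bracket A X))^T.
  by rewrite bracket_tr // linearN /= bracket_tr // opprK.
rewrite /ssp_operator brr !linearD /= trmxK; congr (_ + _ + _).
  by apply/matrixP=> a b; rewrite !mxE free_pair_sym.
by rewrite linearN /= trmxK.
Qed.

HB.instance Definition _ A :=
  GRing.isLinear.Build R 'M[R]_n 'M[R]_n _
    (ssp_operator A) (ssp_operator_is_linear A).

Lemma ssp_operator_form A X : A^T = A ->
  \tr (X^T *m ssp_operator A X) *+ 2 =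
  \tr ((free_part X)^T *m free_part X) *+ 2 +
  \tr ((bracket A X)^T *m bracket A X) *+ 2 +
  \tr ((X - X^T)^T *m (X - X^T)).
Proof.
move=> symA; rewrite /ssp_operator mulmxDr [_ *m (_ + bracket _ _)]mulmxDr.
rewrite 2!mxtraceD 2!mulrnDl.
congr (_ *+ 2 + _ *+ 2 + _).
- rewrite !trace_trmx_mul; apply: eq_bigr => a _; apply: eq_bigr => b _.
  by rewrite mxE; case: ifP; rewrite ?mulr0 ?mul0r.
- set K := bracket A X.
  have KT : K^T = X^T *m A - A *m X^T by rewrite linearB /= !trmx_mul symA.
  rewrite [bracket A K]/bracket; clearbody K.
  rewrite KT mulmxBr mulmxBl !raddfB /= [X^T *m (K *m A)]mulmxA.
  by rewrite [\tr (X^T *m K *m A)]mxtrace_mulC !mulmxA.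
- rewrite [(X - X^T)^T]linearB /= trmxK mulmxBl !mulmxBr !raddfB /=.
  rewrite -[\tr (X *m X)]mxtrace_tr trmx_mul [\tr (X *m X^T)]mxtrace_mulC.
  by rewrite mulr2n opprK [- _ + \tr _]addrC.
Qed.

(** If [T1 + T2] is everything, a symmetric [X] orthogonal to both is orthogonal
    to itself.  Conversely, if only zero is orthogonal to both, the form of
    [ssp_operator] is definite, so this operator is injective, hence onto. *)
Lemma SSP_commutant A : A^T = A ->
  SSP G A <->
  forall X, X^T = X -> A *m X = X *m A ->
    (forall a b, free_pair G a b -> X a b = 0) -> X = 0.
Proof.
move=> symA; split=> [sspA X symX commX X0 | inj_comm].
  have : Defs.Sym X by [].
  rewrite -sspA => -[B /T1P[symB B0] [_ [K skewK <-] eX]].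
  apply: trace_square_eq0; rewrite -{2}eX !mulmxDr !raddfD /= symX.
  have -> : \tr (X *m B) = 0.
    rewrite -{1}symX trace_trmx_mul big1 // => a _; rewrite big1 // => b _.
    by case: (boolP (free_pair G a b)) => [/X0|/B0] ->; rewrite ?mul0r ?mulr0.
  rewrite add0r skewK mulNmx mulmxN raddfN /= mulmxA mxtrace_mulC !mulmxA.
  by rewrite commX addNr.
apply/seteqP; split=> [_ [B /T1P[symB _] [_ [K skewK <-] <-]] | Y symY].
  change ((B + (K^T *m A + A *m K))^T = B + (K^T *m A + A *m K)).
  by rewrite !linearD /= !trmx_mul trmxK symA symB [A *m K + _]addrC.
have inj_op : injective (ssp_operator A).
  apply: raddf_inj => X opX; have := ssp_operator_form X symA.
  rewrite opX mulmx0 raddf0 mul0rn => /esym/eqP.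
  rewrite 2?paddr_eq0 ?addr_ge0 ?mulrn_wge0 ?trace_square_ge0 // !mulrn_eq0 /=.
  case/andP=> /andP[/eqP/trace_square_eq0 X0 /eqP/trace_square_eq0/eqP comm].
  move/eqP/trace_square_eq0/eqP; rewrite subr_eq0 eq_sym => /eqP symX.
  rewrite subr_eq0 in comm; apply: inj_comm => // [|a b Gab]; first exact/eqP.
  by move/matrixP/(_ a b): X0; rewrite !mxE Gab.
have [X opX] := linear_inj_surj inj_op Y.
(* The operator commutes with transposition and is injective. *)
have symX : X^T = X.
  by apply: inj_op; rewrite ssp_operator_tr // opX; exact: symY.
exists (free_part X).
  apply/T1P; split=> [|a b nGab]; last by rewrite mxE (negbTE nGab).
  by apply/matrixP=> a b; rewrite !mxE free_pair_sym -[in LHS]symX mxE.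
exists (bracket A (bracket A X)); last first.
  by rewrite -opX /= /ssp_operator symX subrr addr0.
have skewK : (bracket A X)^T = - bracket A X.
  by rewrite -{2}symX bracket_tr // opprK.
by exists (bracket A X); rewrite // skewK mulNmx addrC.
Qed.

End StrongSpectralProperty.

(** * The equivalence *)

Theorem theorem5p3 (R : realType) (n : nat) (G : graph n) (A : 'M[R]_n)
    (hA : SG G A) :
  \rank (graph_jacobian G A) = n <-> distinct_eigenvalues A /\ SSP G A.
Proof.
have symA : A^T = A by case: hA.
rewrite (SSP_commutant G symA).
(* The polynomial calculus of matrices needs a positive size. *)
case: n => [|n'] in G A hA symA *.
  split=> [_|_]; last by apply/eqP; rewrite -leqn0 rank_leq_row.
  split=> [|X _ _ _]; last by rewrite [X]flatmx0.
  by exists [::]; rewrite // big_nil /char_poly det_mx00.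
rewrite jacobian_full_rank distinct_eigenvalues_degree //.
split=> [inj_tr | [degA inj_comm] p size_p tr0].
  have degA : degree_mxminpoly A = n'.+1.
    have := dvdp_leq (monic_neq0 (char_poly_monic A)) (mxminpoly_dvd_char A).
    rewrite size_char_poly size_mxminpoly ltnS leq_eqVlt => /orP[/eqP//|lt_dn].
    (* Otherwise the minimal polynomial of A violates injectivity. *)
    suff min0 : mxminpoly A = 0.
      have := mxminpoly_monic A.
      by rewrite min0 monicE lead_coef0 eq_sym oner_eq0.
    apply: inj_tr => [|j]; first by rewrite size_mxminpoly.
    by rewrite mx_root_minpoly mul0mx raddf0.
  split=> // X symX commX X0.
  have [p size_p Xp] := commutant_poly symA degA commX.
  rewrite Xp (inj_tr p) ?raddf0 //; rewrite -Xp.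
  by apply/(traces_free_positions G symX).
have symX : (horner_mx A p)^T = horner_mx A p by rewrite tr_horner_mx symA.
have X0 : horner_mx A p = 0.
  apply: inj_comm => //; first by apply/comm_mx_horner.
  exact/(traces_free_positions G symX).
(* A nonzero p would be a multiple of the minimal polynomial. *)
apply/eqP/negPn/negP=> p_neq0; have := dvdp_leq p_neq0 (mxminpoly_min X0).
by rewrite size_mxminpoly degA leqNgt ltnS size_p.
Qed.
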